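(* Assume $\mathfrak{d}=\omega_1$. Let $X$ be a Tychonoff space of weight at most $\omega_1$. Then the nabla product $\nabla X^\omega$ is hereditarily $D$, and if in addition $X$ is compact, then the box product $\square X^\omega$ is a $D$-space.
   Context: $\mathfrak{d}$ is the minimal size of a cofinal family in $\omega^\omega$ with the coordinatewise order. The weight of $X$ is the minimal size of a base. A neighbornet on a space $(X,\tau)$ is a map $U:X\to\tau$ with $x\in U(x)$ for all $x\in X$. $X$ is a $D$-space if for every neighbornet $U$ on $X$ there is a closed discrete $D\subseteq X$ with $\bigcup_{x\in D}U(x)=X$. A space is hereditarily $D$ if each of its subspaces is a $D$-space. $\square X^\omega$ is the set $X^\omega$ with the topology generated by all sets $\prod_{n\in\omega} U_n$ with every $U_n$ open in $X$. $\nabla X^\omega$ is the quotient space $(\square X^\omega)/{=^*}$, where $x=^*y$ iff $x(n)=y(n)$ for all but finitely many $n$. *)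

(* Defs.v *)
(* MathComp-Analysis; topological spaces are `topologicalType`s, which may be
   empty. *)
From HB Require Import structures.
From mathcomp Require Import all_boot.
From mathcomp Require Import all_classical.
From mathcomp Require wochoice.
From mathcomp Require Import topology normedtype.

Set Implicit Arguments.
Unset Strict Implicit.
Unset Printing Implicit Defensive.

Local Open Scope classical_set_scope.
Local Open Scope card_scope.
Local Open Scope quotient_scope.

Definition least_size {T : Type} (P : set (set T)) (A : set T) : Prop :=
  P A /\ forall B, P B -> A #<= B.

(* An arbitrary well-order of the set [set nat], which is uncountable. *)
Definition wo : rel (set nat) :=
  sval (wochoice.well_ordering_principle (set nat)).

(* The elements having only countably many predecessors: an uncountable initial
   segment of [wo] (omega1_uncountable, omega1_initial) each of whose own
   initial segments is countable by definition, hence of order type omega_1. *)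
Definition omega1 : set (set nat) := [set x | countable [set y | wo y x]].

Lemma wo_well_order : wochoice.well_order wo.
Proof. exact: (svalP (wochoice.well_ordering_principle (set nat))). Qed.

Lemma wo_wo_chain : wochoice.wo_chain wo predT.
Proof. by move=> A _; exact: wo_well_order. Qed.

Lemma wo_total x y : wo x y || wo y x.
Proof. exact: (wochoice.wo_chainW wo_wo_chain). Qed.

Lemma wo_anti x y : wo x y -> wo y x -> x = y.
Proof.
move=> xy yx; apply: (wochoice.wo_chain_antisymmetric wo_wo_chain) => //.
by rewrite xy yx.
Qed.

Lemma wo_trans x y z : wo x y -> wo y z -> wo x z.
Proof.
move=> xy yz.
have [|m [[mP mlb] _]] := @wo_well_order (mem [:: x; y; z]).
  by exists x; rewrite inE eqxx.
have xm : wo m x by apply: mlb; rewrite !inE eqxx.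
have ym : wo m y by apply: mlb; rewrite !inE eqxx orbT.
have zm : wo m z by apply: mlb; rewrite !inE eqxx !orbT.
move: mP; rewrite !inE => /or3P[] /eqP mE; subst m => //.
  by have -> : x = y by exact: wo_anti.
have yzE : y = z by exact: wo_anti.
by rewrite -yzE.
Qed.

Lemma omega1_initial x y : omega1 x -> wo y x -> omega1 y.
Proof.
move=> x1 yx; apply: sub_countable x1; apply: subset_card_le => z /= zy.
exact: wo_trans zy yx.
Qed.

Lemma omega1_uncountable : ~ countable omega1.
Proof.
move=> c1.
have [omegaT|] := pselect (omega1 = setT).
  move: c1; rewrite omegaT => /pcard_injP[f f_inj].
  pose D := [set n | exists2 A, f A = n & ~ A n].
  have finj A B : f A = f B -> A = B by apply: f_inj; rewrite inE.
  have [DD|nDD] := pselect (D (f D)).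
    by case: (DD) => A /finj -> nA; exact: nA.
  by apply: (nDD); exists D.
move=> neT; have [a na] : exists a, ~ omega1 a.
  by apply/existsNP => all1; apply: neT; apply/seteqP; split.
have [|m [[mP mlb] _]] := @wo_well_order (mem (~` omega1)).
  by exists a; rewrite inE.
move: mP; rewrite inE /= => nm; apply: nm.
apply: (@sub_countable _ _ _ (omega1 `|` [set m])); last first.
  have -> : omega1 `|` [set m] =
      \bigcup_(b in [set: bool]) if b then omega1 else [set m].
    apply/seteqP; split=> [z [z1|zm]|z [[] _ zb]].
    - by exists true.
    - by exists false.
    - by left.
    - by right.
  by apply: bigcup_countable => // -[] _ //; exact: countable1.
apply: subset_card_le => z /= zm.
have [|nz] := pselect (omega1 z); first by left.
by right; apply: wo_anti zm _; apply: mlb; rewrite inE.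
Qed.

Definition cofinal_family (F : set (nat -> nat)) : Prop :=
  forall g : nat -> nat, exists2 f, F f & forall n, (g n <= f n)%N.

Definition dominating_number_eq_omega1 : Prop :=
  exists2 F, least_size cofinal_family F & F #= omega1.

Definition weight_le_omega1 (X : topologicalType) : Prop :=
  exists2 B : set (set X), least_size basis B & B #<= omega1.

(* [completely_regular_space] does not include any separation axiom; in terms
   of real-valued functions it is [uniform_separatorP]. *)
Definition tychonoff_space (X : topologicalType) : Prop :=
  completely_regular_space X /\ hausdorff_space X.

Definition neighbornet (X : topologicalType) (U : X -> set X) : Prop :=
  forall x, open (U x) /\ U x x.

Definition discrete_subset (X : topologicalType) (D : set X) : Prop :=
  D `<=` isolated D.

Definition D_space (X : topologicalType) : Prop :=
  forall U : X -> set X, neighbornet U ->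
    exists D : set X,
      [/\ closed D, discrete_subset D & \bigcup_(x in D) U x = [set: X]].

(* [set_type A] carries the subspace topology. *)
Definition hereditarily_D (X : topologicalType) : Prop :=
  forall A : set X, D_space (set_type A).

(* An alias, as plain arrow types may receive the product topology. *)
Definition box_product (X : Type) : Type := nat -> X.

Section box_topology.
Variable X : topologicalType.

Definition box (U : nat -> set X) : set (box_product X) :=
  [set x | forall n, U n (x n)].

Definition open_factors : set (nat -> set X) := [set U | forall n, open (U n)].

Lemma box_cover : \bigcup_(U in open_factors) box U = setT.
Proof.
by apply/seteqP; split=> // x _; exists (fun=> setT) => // n; exact: openT.
Qed.

Lemma box_join U V x : open_factors U -> open_factors V ->
  box U x -> box V x ->
  exists W, [/\ open_factors W, box W x & box W `<=` box U `&` box V].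
Proof.
move=> oU oV Ux Vx; exists (fun n => U n `&` V n); split.
- by move=> n; exact: openI.
- by move=> n; split; [exact: Ux|exact: Vx].
- by move=> y UVy; split=> n; have [] := UVy n.
Qed.

HB.instance Definition _ := gen_eqMixin (box_product X).
HB.instance Definition _ := gen_choiceMixin (box_product X).
HB.instance Definition _ :=
  isBaseTopological.Build (box_product X) box_cover box_join.

End box_topology.

Section nabla_topology.
Variable X : topologicalType.

Definition eqstar (x y : box_product X) : bool :=
  `[< finite_set [set n | x n <> y n] >].

Lemma eqstar_refl : reflexive eqstar.
Proof.
move=> x; apply/asboolP; rewrite (_ : [set n | _] = set0) //.
by apply/seteqP; split=> n //=; apply.
Qed.

Lemma eqstar_sym : symmetric eqstar.
Proof.
move=> x y; apply/asboolP/asboolP; apply: sub_finite_set => n /= + e.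
  by apply; rewrite e.
by apply; rewrite e.
Qed.

Lemma eqstar_trans : transitive eqstar.
Proof.
move=> y x z /asboolP xy /asboolP yz; apply/asboolP.
apply: (@sub_finite_set _ _ ([set n | x n <> y n] `|` [set n | y n <> z n])).
  move=> n /= xz; have [e|] := pselect (x n = y n); last by left.
  by right; rewrite -e.
by rewrite finite_setU.
Qed.

Canonical eqstar_equiv := EquivRel eqstar eqstar_refl eqstar_sym eqstar_trans.

Definition nabla_product : Type := quotient_topology {eq_quot eqstar_equiv}.

HB.instance Definition _ := Topological.on nabla_product.
HB.instance Definition _ := Quotient.on nabla_product.

End nabla_topology.

(* Main.v *)
Require Import Defs.
From mathcomp Require Import all_boot.
From mathcomp Require Import all_classical.
From mathcomp Require wochoice.
From mathcomp Require Import topology normedtype.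

(** The nabla product is shown to be omega_1-metrizable: its topology comes from
    a decreasing sequence of type omega_1 of equivalence relations with open
    classes [nabla_omega1_metrizable].  Complete regularity and the weight give
    omega_1 many continuous pseudometrics on X, arranged in countable blocks
    such that any countably many neighborhoods are witnessed in one block
    [weight_gauges].  A cofinal family of size omega_1 then bounds how far in the
    block the n-th coordinate has to look, so that omega_1 many relations between
    sequences suffice.  They are open because countable intersections of open
    sets are open in a nabla product [box_diagonal], and level b of the sequence
    may simply impose all of the countably many conditions indexed below b.

    An omega_1-metrizable T1 space is D for the same reason as a metrizable one
    [omega1_metrizable_D]: choosing kernel points greedily, those with large
    neighborhoods first, leaves near any point at most one kernel point for each
    of countably many levels, and countable sets are closed and discrete here.
    Omega_1-metrizability and T1 pass to subspaces, whence the hereditary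
    statement.

    When X is compact, each class is a countable union of compact subsets of the
    box product, obtained by freeing the first n coordinates, and the tube lemma
    makes the quotient map closed [nabla_pi_closed].  Sigma-compact fibers have
    closed discrete kernels [sigma_compact_kernel], and these are glued along a
    kernel of the nabla product [closed_map_D]. *)

Set Implicit Arguments.
Unset Strict Implicit.
Unset Printing Implicit Defensive.

Local Open Scope classical_set_scope.
Local Open Scope card_scope.
Local Open Scope quotient_scope.

(** * Countable sets are bounded in omega_1 *)

Lemma wo_refl x : wo x x.
Proof. by have := wo_total x x; rewrite orbb. Qed.

Lemma omega1_neq0 : omega1 !=set0.
Proof.
by apply/set0P/eqP => e; apply: omega1_uncountable; rewrite e; exact: countable0.
Qed.

Lemma omega1_ub2 a b : omega1 a -> omega1 b ->
  exists c, [/\ omega1 c, wo a c & wo b c].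
Proof.
move=> a1 b1; have [ab|ba] := orP (wo_total a b).
  by exists b; split=> //; exact: wo_refl.
by exists a; split=> //; exact: wo_refl.
Qed.

Lemma omega1_bounded (A : set (set nat)) : A `<=` omega1 -> countable A ->
  exists2 c, omega1 c & forall a, A a -> wo a c.
Proof.
move=> A1 cA; apply: contrapT => nub.
apply: omega1_uncountable.
apply: (@sub_countable _ _ _ (\bigcup_(a in A) [set y | wo y a])); last first.
  by apply: bigcup_countable => // a /A1.
apply: subset_card_le => c c1.
have [a [Aa nac]] : exists a, A a /\ ~ wo a c.
  apply: contrapT => na; apply: nub; exists c => // a Aa.
  by apply: contrapT => nac; apply: na; exists a.
by exists a => //=; case/orP: (wo_total a c).
Qed.

Lemma omega1_bounded_seq (u : nat -> set nat) : (forall n, omega1 (u n)) ->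
  exists2 c, omega1 c & forall n, wo (u n) c.
Proof.
move=> u1; have [||c c1 uc] := @omega1_bounded (range u).
- by move=> _ [n _ <-].
- by apply: card_image_le.
- by exists c => // n; apply: uc; exists n.
Qed.

Lemma omega1_enum (T : pointedType) (A : set T) : A #<= omega1 ->
  exists e : set nat -> T, forall a, A a -> exists2 x, omega1 x & e x = a.
Proof.
move=> /pfcard_geP[->|[e]]; first by exists (fun=> point).
by exists e => a /(@surj _ _ _ _ e)[x x1 ex]; exists x.
Qed.

Lemma countable_enum (T : pointedType) (A : set T) : countable A ->
  exists s : nat -> T, forall a, A a -> exists m, s m = a.
Proof.
move=> /pfcard_geP[->|[e]]; first by exists (fun=> point).
by exists e => a /(@surj _ _ _ _ e)[x x1 ex]; exists x.
Qed.

(** * Closed discrete sets *)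

(** Closedness is the condition at the points outside D, discreteness the one at
    the points of D. *)
Definition closed_discrete (T : topologicalType) (D : set T) :=
  forall z, \forall y \near z, D y -> y = z.

Lemma closed_discreteP (T : topologicalType) (D : set T) :
  closed_discrete D <-> closed D /\ discrete_subset D.
Proof.
split=> [cdD|[clD dD] z].
  split=> [z|z Dz].
    by move=> /(_ _ (cdD z))[y [Dy /(_ Dy) <-]].
  split; first exact/mem_set.
  exists [set y | D y -> y = z]; first exact: cdD.
  by apply/seteqP; split=> [y [/[apply]]|_ ->].
have [Dz|nDz] := pselect (D z).
  have [_ [V zV VD]] := dD z Dz.
  by apply: filterS zV => y Vy Dy; rewrite -[_ = _]/([set z] y) -VD.
have /filterS : nbhs z (~` D).
  by apply: open_nbhs_nbhs; split=> //; exact: closed_openC.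
by apply=> y.
Qed.

Lemma accessible_near_neq (T : topologicalType) (x y : T) :
  accessible_space T -> x <> y -> \forall z \near x, z <> y.
Proof.
move=> T1 xy; have /closed_openC oy := @accessible_closed_set1 _ T1 y.
exact: (open_nbhs_nbhs (conj oy xy)).
Qed.

Lemma locally_finite_closed_discrete (T : topologicalType) (D : set T) :
  accessible_space T ->
  (forall z : T, exists s : seq T, \forall y \near z, D y -> y \in s) ->
  closed_discrete D.
Proof.
move=> T1 lfD z; have [s] := lfD z.
suff : \forall y \near z, y \in s -> y = z.
  by apply: filterS2 => y yz ys Dy; exact: yz (ys Dy).
elim: s => [|d s IHs]; first exact: nearW.
have [->|/eqP dz] := eqVneq d z.
  by apply: filterS IHs => y ys; rewrite inE => /orP[/eqP|].
have := accessible_near_neq T1 (nesym dz).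
by apply: filterS2 IHs => y ys yd; rewrite inE => /orP[/eqP|].
Qed.

(** * Linearly uniformizable spaces are D *)

(** Well-founded recursion in the form of a fixed-point equation, which is all
    that the study of greedy kernels needs. *)
Lemma greedy_kernel (T : Type) (R : T -> T -> Prop) (U : T -> set T) :
  well_founded R ->
  exists D : set T, forall x, D x <-> forall y, R y x -> D y -> ~ U y x.
Proof.
move=> wfR.
pose F x (D : forall y, R y x -> Prop) := forall y (yx : R y x), D y yx -> ~ U y x.
exists (Fix wfR _ F) => x; rewrite Fix_eq //.
move=> {}x f g fg; congr F; apply: functional_extensionality_dep => y.
exact: functional_extensionality_dep (fg y).
Qed.

Lemma well_order_wf (T : eqType) (R : rel T) : wochoice.well_order R ->
  well_founded (fun x y => R x y /\ x <> y).
Proof.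
move=> wR x; apply: contrapT => nx.
have [|m [[mP mlb] _]] := wR (mem [set x | ~ Acc (fun x y => R x y /\ x <> y) x]).
  by exists x; rewrite inE.
move: mP; rewrite inE /=; apply; constructor => y [ym ny].
apply: contrapT => nAy; apply: ny.
have my : R m y by apply: mlb; rewrite inE.
have tR : wochoice.wo_chain R predT by move=> A _; exact: wR.
by apply: (wochoice.wo_chain_antisymmetric tR) => //; rewrite ym my.
Qed.

Lemma lex_wf (A B : Type) (RA : A -> A -> Prop) (RB : B -> B -> Prop) (f : B -> A) :
  well_founded RA -> well_founded RB ->
  well_founded (fun x y => RA (f x) (f y) \/ f x = f y /\ RB x y).
Proof.
move=> wA wB x; move: {2}(f x) (erefl (f x)) => a.
elim/(well_founded_ind wA): a x => a IHa x.
elim/(well_founded_ind wB): x => x IHx fx.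
constructor=> y [fyx|[fyx yx]].
  by apply: (IHa (f y)) => //; rewrite -fx.
by apply: IHx => //; rewrite fyx.
Qed.

(** The analogue of a metric for a space whose points have neighborhood bases
    of type omega_1: F b plays the role of distance less than 1/b.  As countably
    many of these relations have a common lower bound, they can be taken to be
    equivalence relations. *)
Definition omega1_metrization (T : topologicalType)
    (F : set nat -> T -> T -> Prop) :=
  [/\ forall b, (forall x y, F b x y -> F b y x) /\
                (forall x y z, F b x y -> F b y z -> F b x z),
      forall b c x y, wo b c -> F c x y -> F b x y,
      forall b x, omega1 b -> nbhs x (F b x) &
      forall x A, nbhs x A -> exists2 b, omega1 b & F b x `<=` A].

Definition omega1_metrizable (T : topologicalType) :=
  exists F, @omega1_metrization T F.

Lemma omega1_metrizable_sub (T : topologicalType) (A : set T) :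
  omega1_metrizable T -> omega1_metrizable (set_type A).
Proof.
move=> [F [eqF decF nbhsF baseF]].
exists (fun b x y => F b (set_val x) (set_val y)); split.
- move=> b; have [Fs Ft] := eqF b.
  by split=> [x y|x y z]; [exact: Fs|exact: Ft].
- by move=> b c x y; exact: decF.
- by move=> b x b1; exact: (@initial_continuous A T set_val x _ (nbhsF _ _ b1)).
- move=> x W; rewrite nbhsE => -[_ [[V oV <-] Vx] VW].
  have [b b1 FV] := baseF _ _ (open_nbhs_nbhs (conj oV Vx)).
  by exists b => // y /FV /VW.
Qed.

Lemma accessible_sub (T : topologicalType) (A : set T) :
  accessible_space T -> accessible_space (set_type A).
Proof.
move=> T1 x y xy; have [|V [oV xV yV]] := T1 (set_val x) (set_val y).
  by apply: contra_neq xy => /val_inj.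
exists (set_val @^-1` V); split; [by exists V|exact: xV|exact: yV].
Qed.

(** Countably many points other than z are separated from z by countably many
    classes of z, hence by one of them, as omega_1 has no countable cofinal
    subset. *)
Lemma omega1_metrizable_locally_countable (T : topologicalType) (D : set T) :
  omega1_metrizable T -> accessible_space T ->
  (forall z : T, exists2 O, nbhs z O & countable (D `&` O)) ->
  closed_discrete D.
Proof.
move=> [F [_ decF nbhsF baseF]] T1 lcD z; have [O zO cDO] := lcD z.
have /choice[g gP] : forall y, exists b, omega1 b /\ (y <> z -> ~ F b z y).
  move=> y; have [->|yz] := pselect (y = z).
    by have [b b1] := omega1_neq0; exists b.
  have [b b1 bN] := baseF _ _ (accessible_near_neq T1 (nesym yz)).
  by exists b; split=> // _ /bN.
have [||c c1 gc] := @omega1_bounded (g @` (D `&` O)).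
- by move=> _ [y _ <-]; have [] := gP y.
- exact: card_le_trans (card_image_le _ _) cDO.
apply: filterS2 zO (nbhsF c z c1) => y Oy Fzy Dy.
apply: contrapT => yz; have [_ /(_ yz)] := gP y; apply.
by apply: decF Fzy; apply: gc; exists y.
Qed.

(** Each point x gets a level b x whose class of x lies in U x.  The kernel is
    chosen greedily, lower levels first.  A kernel point x at level b swallows
    its whole class, so no other kernel point of level b is equivalent to it;
    and an open set U x, x in the kernel, contains no kernel point of a later
    level.  Hence near any point the kernel has at most one element at each of
    countably many levels. *)
Lemma omega1_metrizable_D (T : topologicalType) :
  omega1_metrizable T -> accessible_space T -> D_space T.
Proof.
move=> mT T1 U nU; case: (mT) => F [eqF decF nbhsF baseF].
have /choice[b bP] : forall x, exists b, omega1 b /\ F b x `<=` U x.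
  move=> x; have [oU Ux] := nU x.
  by have [b b1 bU] := baseF _ _ (open_nbhs_nbhs (conj oU Ux)); exists b.
have [w ww] := wochoice.well_ordering_principle T.
have w_total x y : w x y || w y x.
  by apply: (@wochoice.wo_chainW _ w predT) => // A _; exact: ww.
pose R x y := (wo (b x) (b y) /\ b x <> b y) \/ b x = b y /\ (w x y /\ x <> y).
have wfR : well_founded R.
  exact: lex_wf (well_order_wf wo_well_order) (well_order_wf ww).
have totR x y : x <> y -> R x y \/ R y x.
  move=> xy; have [bxy|bxy] := pselect (b x = b y).
    by case/orP: (w_total x y) => wxy;
      [left; right|right; right]; do !split=> //; exact: nesym.
  by case/orP: (wo_total (b x) (b y)) => wxy; [left; left|right; left];
    split=> //; exact: nesym.
have leR x y : R x y -> wo (b x) (b y).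
  by case=> [[]//|[-> _]]; exact: wo_refl.
have [D DP] := greedy_kernel U wfR.
have cov z : exists2 x, D x & U x z.
  have [Dz|nDz] := pselect (D z); first by exists z => //; have [] := nU z.
  apply: contrapT => ncov; apply: nDz; apply/DP => y _ Dy Uyz.
  by apply: ncov; exists y.
suff /closed_discreteP[clD dD] : closed_discrete D.
  exists D; split=> //; apply/seteqP; split=> // z _.
  by have [x] := cov z; exists x.
apply: (omega1_metrizable_locally_countable mT T1) => z.
have [x Dx Uxz] := cov z; have [oUx _] := nU x; have [bx1 _] := bP x.
(* U x excludes the levels above b x, and the class of z at level b x separates
   the kernel points of each remaining level. *)
exists (U x `&` F (b x) z).
  by apply: filterI; [exact: open_nbhs_nbhs|exact: nbhsF].
have le_b y : (D `&` (U x `&` F (b x) z)) y -> wo (b y) (b x).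
  move=> [Dy [Uxy _]]; have [->|yx] := pselect (y = x); first exact: wo_refl.
  case: (totR _ _ yx) => [/leR//|xy].
  by have /DP/(_ _ xy Dx) := Dy.
have b_inj : {in D `&` (U x `&` F (b x) z) &, injective b}.
  suff H y y' : (D `&` (U x `&` F (b x) z)) y ->
      (D `&` (U x `&` F (b x) z)) y' -> b y = b y' -> R y y' -> False.
    move=> y y' /set_mem Ay /set_mem Ay' bE; apply: contrapT => /totR[].
      exact: H.
    by apply: H => //; rewrite bE.
  move=> Ay Ay' bE yy'; have [[Dy [_ zy]] [/DP Dy' [_ zy']]] := (Ay, Ay').
  apply: (Dy' _ yy' Dy); have [_] := bP y; apply.
  have [Fs Ft] := eqF (b y).
  apply: (Ft _ z); first by apply: Fs; apply: decF zy; exact: le_b.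
  by apply: decF zy'; exact: le_b.
have /countable_injP[g g_inj] : countable [set y | wo y (b x)] by [].
apply/countable_injP; exists (g \o b) => y y' Ay Ay' /g_inj bE.
apply: b_inj => //; apply: bE; apply/mem_set; apply: le_b; exact/set_mem.
Qed.

(** * The box and nabla topologies *)

Lemma nbhs_bounded (T : topologicalType) (x : T) (P : nat -> set T) M :
  (forall m, (m < M)%N -> nbhs x (P m)) ->
  nbhs x [set y | forall m, (m < M)%N -> P m y].
Proof.
elim: M => [|M IHM] xP; first by apply: filterS filterT.
have := IHM (fun m mM => xP m (leqW mM)).
apply: filterS2 (xP M (leqnn _)) => y PM lt_P m.
by rewrite ltnS leq_eqVlt => /predU1P[->|/lt_P].
Qed.

Lemma finite_set_near (A : set nat) :
  finite_set A <-> \forall n \near \oo, ~ A n.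
Proof.
split=> [/finite_seqP[s ->]|[N _ NA]]; last first.
  apply: (sub_finite_set _ (finite_II N)) => n An /=.
  by rewrite ltnNge; apply/negP => /NA.
elim: s => [|a s IHs]; first exact: nearW.
apply: filterS2 (nbhs_infty_gt a) IHs => n an ns /=.
by rewrite inE => /predU1P[na|//]; rewrite na ltnn in an.
Qed.

Section box_nabla.
Variable X : topologicalType.
Local Notation boxX := (box_product X).
Local Notation nabla := (nabla_product X).
Implicit Types (x y z : boxX) (U : nat -> set X).

Lemma box_nbhsP x (A : set boxX) :
  nbhs x A <-> exists U, [/\ open_factors U, box U x & box U `<=` A].
Proof.
split=> [|[U [oU Ux UA]]].
  rewrite nbhsE => -[_ [[I IO <-] [U IU Ux]] IA].
  by exists U; split=> //; [exact: IO|move=> y Uy; apply: IA; exists U].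
rewrite nbhsE; exists (box U) => //; split=> //.
exists [set U]; first by move=> _ ->.
by apply/seteqP; split=> [y [_ ->]|y Uy]; [|exists U].
Qed.

Lemma nabla_pi_eqP x y :
  \pi_nabla x = \pi_nabla y <-> \forall n \near \oo, x n = y n.
Proof.
transitivity (eqstar x y : Prop).
  split=> [/eqmodP //|xy]; exact/eqmodP.
split=> [/asboolP/finite_set_near|xy].
  by apply: filterS => n /contrapT.
by apply/asboolP/finite_set_near; apply: filterS xy => n xy /(_ xy).
Qed.

Lemma nabla_near_repr (x : boxX) : \forall n \near \oo, repr (\pi_nabla x) n = x n.
Proof. by apply/nabla_pi_eqP; rewrite reprK. Qed.

Lemma nabla_nbhs_box x U : (forall n, nbhs (x n) (U n)) ->
  nbhs (\pi_nabla x) [set a | \forall n \near \oo, U n (repr a n)].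
Proof.
move=> xU.
suff : open_nbhs (\pi_nabla x) [set a | \forall n \near \oo, (U n)° (repr a n)].
  move=> /open_nbhs_nbhs; apply: filterS => a; apply: filterS => n.
  exact: interior_subset.
split; last first.
  by apply: filterS (nabla_near_repr x) => n /= ->; exact: xU.
suff : open [set y : boxX | \forall n \near \oo, (U n)° (y n)].
  congr open; apply/seteqP; split=> y /=.
    by apply: filterS2 (nabla_near_repr y) => n ->.
  by apply: filterS2 (nabla_near_repr y) => n ->.
rewrite openE => y yU; apply/box_nbhsP.
exists (fun n => [set v | (U n)° (y n) -> (U n)° v]); split.
- move=> n; have [Uyn|nUyn] := pselect ((U n)° (y n)).
    rewrite (_ : [set _ | _] = (U n)°); first exact: open_interior.
    by apply/seteqP; split=> v; [move=> /(_ Uyn)|move=> Uv _].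
  rewrite (_ : [set _ | _] = setT); first exact: openT.
  by apply/seteqP; split=> [v _|v _ /nUyn].
- by move=> n.
- by move=> z zU; apply: filterS yU => n; exact: zU.
Qed.

(** Changing finitely many coordinates does not leave a class, so only almost
    all factors of a box around x matter. *)
Lemma nabla_nbhs_sub x (A : set nabla) : nbhs (\pi_nabla x) A ->
  exists U, [/\ open_factors U, box U x &
    forall y, (\forall n \near \oo, U n (y n)) -> A (\pi_nabla y)].
Proof.
move=> /pi_continuous/box_nbhsP[U [oU Ux UA]]; exists U; split=> // y [N _ NU].
pose y' : boxX := fun n => if (n < N)%N then x n else y n.
have -> : \pi_nabla y = \pi_nabla y'.
  by apply/nabla_pi_eqP; exists N => // n /=; rewrite /y' ltnNge => ->.
apply: UA => n; rewrite /y'; case: ltnP => [_|]; [exact: Ux|exact: NU].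
Qed.

Lemma nabla_accessible : accessible_space X -> accessible_space nabla.
Proof.
move=> T1 a b ab.
suff : nbhs a [set c | c <> b].
  rewrite nbhsE => -[V [oV Va] Vb]; exists V; split=> //; apply/mem_set => //.
  by move=> /Vb.
rewrite -[a]reprK; set x := repr a; set y := repr b.
have /nabla_nbhs_box : forall n, nbhs (x n) [set v | x n <> y n -> v <> y n].
  move=> n; have [xy|xy] := pselect (x n = y n).
    by apply: nearW => v /(_ xy).
  by apply: filterS (accessible_near_neq T1 xy) => v vy _.
apply: filterS => c xc cb; move/eqP: ab; apply.
rewrite -[a]reprK -[b]reprK; apply/nabla_pi_eqP.
apply: filterS xc => n; rewrite cb => xc; apply: contrapT => /xc; exact.
Qed.

(** The diagonal argument making countable intersections of open sets open in
    a nabla product: the n-th factor only has to meet the first n conditions. *)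
Lemma box_diagonal (I : Type) (C : set I) (W : I -> nat -> set X) x :
  countable C -> (forall i n, C i -> nbhs (x n) (W i n)) ->
  exists U, (forall n, nbhs (x n) (U n)) /\
    forall y, (\forall n \near \oo, U n (y n)) ->
    forall i, C i -> \forall n \near \oo, W i n (y n).
Proof.
move=> /countable_injP[c c_inj] xW.
exists (fun n => [set v | forall m, (m < n)%N ->
  forall i, C i -> c i = m -> W i n v]); split=> [n|y yU i Ci].
  apply: nbhs_bounded => m _.
  have [[i [Ci <-]]|nCm] := pselect (exists i, C i /\ c i = m).
    apply: filterS (xW i n Ci) => v Wv j Cj /c_inj ji.
    by rewrite ji //; exact/mem_set.
  by apply: nearW => v i Ci cim; case: nCm; exists i.
by apply: filterS2 (nbhs_infty_gt (c i)) yU => n cin /(_ _ cin i Ci erefl).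
Qed.

End box_nabla.

(** * Tychonoff spaces of weight at most omega_1 *)

(** A countable base of a uniformity coarser than the topology, which amounts to
    a continuous pseudometric with E k x y read as distance less than 2^-k. *)
Definition gauge (X : topologicalType) (E : nat -> X -> X -> Prop) :=
  [/\ forall k x y, E k x y -> E k y x,
      forall k x y z, E k.+1 x y -> E k.+1 y z -> E k x z &
      forall k x, nbhs x (E k x)].

Lemma gauge_true (X : topologicalType) : gauge (fun _ (_ _ : X) => True).
Proof. by split=> // k x; exact: filterT. Qed.

Lemma completely_regular_gauge (X : topologicalType) (x : X) (A : set X) :
  completely_regular_space X -> nbhs x A ->
  exists2 E, gauge E & E 0%N x `<=` A.
Proof.
move=> crX; rewrite nbhsE => -[O [oO Ox] OA].
have [||uT [E [entE EO nbhsT]]] := crX x (~` O); [exact: open_closedC|by apply|].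
pose UT := Uniform.Pack uT.
pose fix ent k : set (UT * UT) := if k is k'.+1 then split_ent (ent k') else E.
have entP k : entourage (ent k).
  by elim: k => [//|k IHk] /=; exact: entourage_split_ent.
exists (fun k y z => ent k (y, z) /\ ent k (z, y)).
  split=> [k y z []//|k y z w [yz zy] [zw wz]|k y].
    by split; [exact: (@entourage_split UT z y w)|exact: (@entourage_split UT z w y)].
  apply: nbhsT; apply: filterI.
    have := nbhs_entourage (y : UT) (entP k).
    by apply: filterS => z /xsectionP.
  have := nbhs_entourage (y : UT) (entourage_inv (entP k)).
  by apply: filterS => z /xsectionP.
move=> y [Exy _]; apply: OA; apply: contrapT => nOy.
by have : set0 (x, y) by rewrite -EO.
Qed.

(** Each block S a is a countable family of continuous pseudometrics, and any
    countably many neighborhoods are witnessed within a single block.  This is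
    where the weight enters: the pseudometrics are indexed by pairs of basic
    open sets, hence by pairs of countable ordinals, and S a lists the pairs
    below a. *)
Lemma weight_gauges (X : topologicalType) :
  completely_regular_space X -> weight_le_omega1 X ->
  exists2 S : set nat -> nat -> nat -> X -> X -> Prop,
    forall a m, gauge (S a m) &
    forall (x : nat -> X) (U : nat -> set X), (forall n, nbhs (x n) (U n)) ->
      exists2 a, omega1 a & forall n, exists m, S a m 0%N (x n) `<=` U n.
Proof.
move=> crX [B [[oB baseB] _] /omega1_enum[e eB]].
have /choice[G GP] : forall p : set nat * set nat, exists E, gauge E /\
    ((exists2 E', gauge E' & forall x, e p.1 x -> E' 0%N x `<=` e p.2) ->
     forall x, e p.1 x -> E 0%N x `<=` e p.2).
  move=> p; have [[E gE EP]|nE] := pselect (exists2 E', gauge E' &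
    forall x, e p.1 x -> E' 0%N x `<=` e p.2); first by exists E; split.
  by exists (fun _ _ _ => True); split=> //; exact: gauge_true.
have /choice[s sP] : forall a, exists s : nat -> set nat * set nat, omega1 a ->
    forall b c, wo b a -> wo c a -> exists m, s m = (b, c).
  move=> a; have [a1|na1] := pselect (omega1 a); last by exists (fun=> point).
  have [s sP] := countable_enum (countableX a1 a1).
  by exists s => _ b c ba ca; apply: sP.
exists (fun a m => G (s a m)) => [a m|x U xU]; first by have [] := GP (s a m).
have baseP (y : X) A : nbhs y A -> exists a, [/\ omega1 a, nbhs y (e a) & e a `<=` A].
  move=> yA; have [V [BV Vy] VA] := baseB y A yA.
  have [a a1 eV] := eB V BV.
  exists a; rewrite eV; split=> //.
  by apply: open_nbhs_nbhs; split=> //; exact: oB.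
have /choice[c cP] : forall n, exists c,
    [/\ omega1 c, nbhs (x n) (e c) & e c `<=` U n].
  by move=> n; exact: baseP.
have /choice[b bP] : forall n, exists b, [/\ omega1 b, nbhs (x n) (e b) &
    exists2 E, gauge E & forall y, e b y -> E 0%N y `<=` e (c n)].
  move=> n; have [_ xc _] := cP n.
  have [E gE Ec] := completely_regular_gauge crX xc; have [Es Et En] := gE.
  (* One halving step is spent on making E work at all points near x n, so that
     it depends on x n through a basic open set only. *)
  have [b [b1 xb bE]] := baseP _ _ (En 1%N (x n)).
  exists b; split=> //; exists (fun k => E k.+1).
    by split=> [k|k|k]; [exact: Es|exact: Et|exact: En].
  by move=> y /bE xy z yz; apply: Ec; exact: Et xy yz.
have [c' c'1 c'P] : exists2 a, omega1 a & forall n, wo (c n) a.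
  by apply: omega1_bounded_seq => n; have [] := cP n.
have [b' b'1 b'P] : exists2 a, omega1 a & forall n, wo (b n) a.
  by apply: omega1_bounded_seq => n; have [] := bP n.
have [a [a1 ba ca]] := omega1_ub2 b'1 c'1.
exists a => // n; have [m sm] := sP a a1 _ _ (wo_trans (b'P n) ba) (wo_trans (c'P n) ca).
exists m; have [_ xb Eb] := bP n; have [_ _ cU] := cP n.
have [_ /=] := GP (s a m); rewrite sm /= => /(_ Eb) Gb y Gy; apply: cU.
by apply: Gb Gy; exact: nbhs_singleton.
Qed.

(** * Nabla products are omega_1-metrizable *)

Lemma dominating_enum : dominating_number_eq_omega1 ->
  exists f : set nat -> nat -> nat,
    forall g : nat -> nat, exists2 a, omega1 a & forall n, (g n <= f a n)%N.
Proof.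
move=> [F [cofF _]]; rewrite card_eq_le => /andP[/omega1_enum[f fF] _].
exists f => g; have [h Fh gh] := cofF g.
by have [a a1 fa] := fF h Fh; exists a => // n; rewrite fa.
Qed.

(** Two classes x and y are equivalent at level b when, for all a, d <= b and
    every k, almost every n is such that x n and y n are 2^-k-close for the
    pseudometrics of the block S a up to position f d n.  Asking this for every
    k gives transitivity.  Neighborhoods: level b imposes countably many
    conditions, which the diagonal argument meets at once.  Base: the
    pseudometrics isolating x n in the n-th factor of a box lie in one block
    S a, at positions that depend on n and are bounded by a dominating f d. *)
Lemma nabla_omega1_metrizable (X : topologicalType) :
  dominating_number_eq_omega1 -> completely_regular_space X ->
  weight_le_omega1 X -> omega1_metrizable (nabla_product X).
Proof.
move=> /dominating_enum[f fP] crX /(weight_gauges crX)[S gS SP].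
pose F b (x y : nabla_product X) := forall a d k, wo a b -> wo d b ->
  \forall n \near \oo, forall m, (m <= f d n)%N -> S a m k (repr x n) (repr y n).
exists F; split.
- move=> b; split=> [x y xy|x y z xy yz] a d k ab db.
    apply: filterS (xy a d k ab db) => n xyn m mf.
    by have [Ss _ _] := gS a m; exact/Ss/xyn.
  apply: filterS2 (xy a d k.+1 ab db) (yz a d k.+1 ab db) => n xyn yzn m mf.
  have [_ St _] := gS a m.
  exact: St (xyn m mf) (yzn m mf).
- move=> b c x y bc xy a d k ab db.
  by apply: xy; exact: wo_trans bc.
- move=> b x b1.
  pose C := ([set a | wo a b] `*` [set d | wo d b]) `*` [set: nat].
  have [||U [xU UF]] := @box_diagonal X _ C
    (fun i n => [set v | forall m, (m < (f i.1.2 n).+1)%N ->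
      S i.1.1 m i.2 (repr x n) v]) (repr x).
  + by apply: countableX => //; exact: countableX.
  + move=> [[a d] k] n _ /=; apply: nbhs_bounded => m _.
    by have [_ _] := gS a m; apply.
  rewrite -[x in nbhs x _]reprK.
  apply: filterS (nabla_nbhs_box xU) => y /UF Fy a d k ab db.
  exact: (Fy ((a, d), k)).
- move=> x A; rewrite -[x in nbhs x _]reprK => /nabla_nbhs_sub[U [oU xU UA]].
  have [|a a1 aP] := SP (repr x) U.
    by move=> n; apply: open_nbhs_nbhs; split; [exact: oU|exact: xU].
  have [g gP] := choice aP; have [d d1 gd] := fP g.
  have [b [b1 ab db]] := omega1_ub2 a1 d1.
  exists b => // y xy; rewrite -[y]reprK; apply: UA.
  by apply: filterS (xy a d 0%N ab db) => n /(_ _ (gd n)); exact: gP.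
Qed.

(** * Closed maps with sigma-compact fibers *)

Lemma compact_finite_subnet (T : topologicalType) (K : set T) (U : T -> set T) :
  compact K -> (forall x, K x -> nbhs x (U x)) ->
  exists2 s : seq T, {in s, forall d, K d} &
    forall x, K x -> exists2 d, d \in s & U d x.
Proof.
move=> /compact_near_coveringP cK nU.
pose I := {s : seq T | {in s, forall d, K d}}.
have Ks0 : {in [::], forall d : T, K d} by [].
(* A near-covering along the filter of finite subsets of K, ordered by
   inclusion, is a finite subcover. *)
pose filt : set_system I :=
  filter_from setT (fun s : I => [set t : I | {subset sval s <= sval t}]).
have filtF : Filter filt.
  apply: filter_from_filter; first by exists (exist _ [::] Ks0).
  move=> [s Ks] [t Kt] _ _.
  have Kst : {in s ++ t, forall d, K d}.
    by move=> d; rewrite mem_cat => /orP[/Ks|/Kt].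
  exists (exist _ (s ++ t) Kst) => // r str.
  by split=> d ds; apply: str; rewrite /= mem_cat ds ?orbT.
have [|[s Ks] _ sK] := cK I filt (fun s x => exists2 d, d \in sval s & U d x).
  move=> x Kx.
  have Kx1 : {in [:: x], forall d, K d} by move=> d; rewrite inE => /eqP ->.
  exists (U x, [set t | x \in sval t]); first split=> /=; first exact: nU.
    by exists (exist _ [:: x] Kx1) => // t /=; apply; rewrite inE.
  by move=> [y t] [/= Uxy xt]; exists x.
by exists s => // x Kx; have /= := sK (exist _ s Ks) (fun _ => id) x Kx.
Qed.

(** The kernel is built by finitely many points at a time: the n-th batch
    covers what the previous ones leave of the n-th compact piece, and avoids
    what they cover.  So U d, for a kernel point d, meets only finitely many
    batches. *)
Lemma sigma_compact_kernel (T : topologicalType) (K : nat -> set T)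
    (U : T -> set T) :
  accessible_space T -> neighbornet U -> (forall n, compact (K n)) ->
  closed (\bigcup_n K n) ->
  exists D, [/\ D `<=` \bigcup_n K n, closed_discrete D &
    \bigcup_n K n `<=` \bigcup_(d in D) U d].
Proof.
move=> T1 nU cK clK.
have nbU x : nbhs x (U x) by have [oU Ux] := nU x; exact: open_nbhs_nbhs.
pose cov (s : seq T) := \bigcup_(d in [set` s]) U d.
have /choice[t tP] : forall p : nat * seq T, exists t : seq T,
    {in t, forall d, (K p.1 `&` ~` cov p.2) d} /\
    K p.1 `<=` cov p.2 `|` cov t.
  move=> [n s] /=.
  have cKs : compact (K n `&` ~` cov s).
    apply: compact_closedI => //; apply: open_closedC.
    by apply: bigcup_open => d _; have [] := nU d.
  have [t tK tcov] := compact_finite_subnet cKs (fun x _ => nbU x).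
  exists t; split=> // x Knx; have [|ncov] := pselect (cov s x); first by left.
  by right; have [d dt Udx] := tcov x (conj Knx ncov); exists d.
pose fix G n : seq T := if n is n'.+1 then G n' ++ t (n', G n') else [::].
have GS n d : d \in G n.+1 = (d \in G n) || (d \in t (n, G n)).
  by rewrite mem_cat.
have Gle m n d : (m <= n)%N -> d \in G m -> d \in G n.
  move=> /subnK <-; elim: (n - m)%N => [//|k IHk] /IHk dG.
  by rewrite addSn GS dG.
have KG n x : K n x -> exists2 d, d \in G n.+1 & U d x.
  have [_ /=] := tP (n, G n) => /[apply] -[[d dG Udx]|[d dt Udx]];
    by exists d => //; rewrite GS ?[d \in t _]dt ?[d \in G n]dG ?orbT.
have G_old n d e m : d \in G n -> U d e -> e \in G (m + n)%N -> e \in G n.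
  move=> dG Ude; elim: m => [//|m IHm].
  rewrite addSn GS => /orP[//|et]; have [/(_ e et)[_ ncov] _] := tP (m + n, G (m + n))%N.
  by case: ncov; exists d => //=; apply: Gle dG; exact: leq_addl.
exists [set d | exists n, d \in G n]; split.
- move=> d [n]; elim: n => [//|n IHn]; rewrite GS => /orP[//|dt].
  by exists n => //; have [/(_ d dt)[]] := tP (n, G n).
- apply: locally_finite_closed_discrete => // z.
  have [[n _ Knz]|nKz] := pselect ((\bigcup_n K n) z).
    have [d dG Udz] := KG n z Knz; exists (G n.+1).
    have [oU _] := nU d; apply: filterS (open_nbhs_nbhs (conj oU Udz)) => e Ude [m em].
    by apply: (G_old n.+1 d e m dG Ude); apply: Gle em; exact: leq_addr.
  exists [::]; apply: filterS (open_nbhs_nbhs (conj (closed_openC clK) nKz)) => e nKe.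
  move=> [n]; elim: n => [//|n IHn]; rewrite GS => /orP[//|et].
  by case: nKe; exists n => //; have [/(_ e et)[]] := tP (n, G n).
- by move=> x [n _ /KG[d dG Udx]]; exists d => //; exists n.+1.
Qed.

(** A kernel of the fiber of s also covers, by closedness of q, the fibers over a
    neighborhood V s of s.  Those over a kernel of V together form a kernel, as
    near any point only one of them is met.  The second hypothesis is closedness
    of q, stated through neighborhoods of fibers. *)
Lemma closed_map_D (T S : topologicalType) (q : T -> S) :
  continuous q ->
  (forall s O, open O -> q @^-1` [set s] `<=` O ->
    \forall s' \near s, q @^-1` [set s'] `<=` O) ->
  (forall U, neighbornet U -> forall s, exists D,
    [/\ D `<=` q @^-1` [set s], closed_discrete D &
        q @^-1` [set s] `<=` \bigcup_(d in D) U d]) ->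
  D_space S -> D_space T.
Proof.
move=> cq clq fibq DS U nU.
have /choice[D DP] := fibq U nU.
pose V s := interior [set s' | q @^-1` [set s'] `<=` \bigcup_(d in D s) U d].
have nV : neighbornet V.
  move=> s; split; first exact: open_interior.
  have [_ _ Ds] := DP s; apply: clq => //.
  by apply: bigcup_open => d _; have [] := nU d.
have [E [clE dE EV]] := DS V nV.
have cdE : closed_discrete E by exact/closed_discreteP.
suff /closed_discreteP[clD dD] : closed_discrete (\bigcup_(s in E) D s).
  exists (\bigcup_(s in E) D s); split=> //; apply/seteqP; split=> // x _.
  have [s Es /interior_subset/(_ x erefl)[d Dd Udx]] : (\bigcup_(s in E) V s) (q x).
    by rewrite EV.
  by exists d => //; exists s.
move=> z; have [_ cdD _] := DP (q z).
have qz : \forall y \near z, E (q y) -> q y = q z := cq z _ (cdE (q z)).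
apply: filterS2 qz (cdD z) => y Ey Dy [s Es Dsy].
have [/(_ y Dsy) /= qy _ _] := DP s.
by apply: Dy; rewrite -Ey ?qy.
Qed.

(** * Box products of compact spaces *)

Section compact_box.
Variable X : topologicalType.
Hypothesis cX : compact [set: X].
Local Notation boxX := (box_product X).
Local Notation nabla := (nabla_product X).

Definition splice n (y z : nat -> X) : boxX :=
  fun m => if (m < n)%N then y m else z m.

Lemma compact_power : compact [set: {ptws nat -> X}].
Proof.
have := @tychonoff nat (fun=> X) (fun=> setT) (fun=> cX).
by congr compact; apply/seteqP; split.
Qed.

(** Splicing is jointly continuous even with the product topology on y, because
    it uses finitely many coordinates of y; so compactness of powers of X applies
    to the box topology. *)
Lemma splice_near n (y : {ptws nat -> X}) (z : boxX) (O : set boxX) :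
  nbhs (splice n y z) O ->
  \forall y' \near y & z' \near z, O (splice n y' z').
Proof.
move=> /box_nbhsP[U [oU Uyz UO]].
exists ([set y' : {ptws nat -> X} | forall m, (m < n)%N -> U m (y' m)],
        [set z' : boxX | forall m, (n <= m)%N -> U m (z' m)]).
  split=> /=.
    apply: (@nbhs_bounded {ptws nat -> X} y (fun m => [set y' | U m (y' m)])).
    move=> m mn; apply: (@proj_continuous nat (fun=> X) m y).
    apply: open_nbhs_nbhs; split; first exact: oU.
    by have := Uyz m; rewrite /splice mn.
  apply/box_nbhsP; exists (fun m => if (n <= m)%N then U m else setT); split.
  - by move=> m; case: ifP => _; [exact: oU|exact: openT].
  - by move=> m; case: ifP => // nm; have := Uyz m; rewrite /splice ltnNge nm.
  - by move=> z' Uz' m nm; have := Uz' m; rewrite nm.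
move=> [y' z'] [/= Uy' Uz']; apply: UO => m; rewrite /splice.
by case: ltnP => [mn|nm]; [exact: Uy'|exact: Uz'].
Qed.

Lemma nabla_fiber (x : boxX) :
  (\pi_nabla : boxX -> nabla) @^-1` [set \pi_nabla x] =
  \bigcup_n range (fun y : {ptws nat -> X} => splice n y x).
Proof.
apply/seteqP; split=> [y /nabla_pi_eqP[n _ xy]|y [n _ [y' _ <-]]].
  exists n => //; exists y => //; apply/funext => m; rewrite /splice.
  by case: ltnP => // /xy.
by apply/nabla_pi_eqP; exists n => // m /=; rewrite /splice ltnNge => ->.
Qed.

Lemma compact_splice n (x : boxX) :
  compact (range (fun y : {ptws nat -> X} => splice n y x)).
Proof.
apply: continuous_compact compact_power.
apply: continuous_subspaceT => y O /splice_near[[P Q] [/= yP xQ] PQ].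
apply: filterS yP => y' Py'; apply: (PQ (y', x)); split=> //=.
exact: nbhs_singleton.
Qed.

(** Kunen's argument that the quotient map is closed when X is compact.  The
    tube lemma gives, for every n, a box U n around x whose points stay in O
    however their first n coordinates are changed; the diagonal box, whose m-th
    factor is the intersection of the U n m with n <= m, works for all n. *)
Lemma nabla_pi_closed (a : nabla) (O : set boxX) : open O ->
  (\pi_nabla : boxX -> nabla) @^-1` [set a] `<=` O ->
  \forall b \near a, (\pi_nabla : boxX -> nabla) @^-1` [set b] `<=` O.
Proof.
rewrite -[a]reprK; set x := repr a => oO xO.
have /choice[U UP] : forall n, exists U, [/\ open_factors U, box U x &
    forall z, box U z -> forall y, O (splice n y z)].
  move=> n.
  suff : \forall z \near x, setT `<=` (fun y : {ptws nat -> X} => O (splice n y z)).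
    move=> /box_nbhsP[U [oU Ux UO]]; exists U; split=> // z Uz y.
    exact: UO Uz y I.
  have /compact_near_coveringP cP := compact_power.
  apply: (cP boxX (nbhs x) (fun z y => O (splice n y z))) => y _.
  apply: splice_near; apply: open_nbhs_nbhs; split=> //; apply: xO.
  by apply/nabla_pi_eqP; exists n => // m /=; rewrite /splice ltnNge => ->.
have : forall m, nbhs (x m) [set v | forall n, (n < m.+1)%N -> U n m v].
  move=> m; apply: nbhs_bounded => n _; have [oU Ux _] := UP n.
  by apply: open_nbhs_nbhs; split; [exact: oU|exact: Ux].
move=> /nabla_nbhs_box; apply: filterS => b bU y /= yb.
have [N _ NU] : \forall m \near \oo, forall n, (n < m.+1)%N -> U n m (y m).
  by apply: filterS2 bU (nabla_near_repr y) => m; rewrite yb => bUm <-.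
have [_ Ux UO] := UP N.
have -> : y = splice N y (splice N x y).
  by apply/funext => m; rewrite /splice; case: ltnP.
apply: UO => m; rewrite /splice; case: ltnP => [_|Nm]; first exact: Ux.
exact: NU.
Qed.

Lemma box_compact_D :
  accessible_space X -> D_space nabla -> D_space boxX.
Proof.
move=> T1; have nT1 := nabla_accessible T1.
have pi_cont : continuous (\pi_nabla : boxX -> nabla) by exact: pi_continuous.
apply: (closed_map_D pi_cont) => [a O|U nU a]; first exact: nabla_pi_closed.
have bT1 : accessible_space boxX.
  move=> x y xy.
  have [n xyn] : exists n, x n <> y n.
    by apply/existsNP => xyE; move/eqP: xy; apply; exact/funext.
  have [|A [oA xA yA]] := T1 (x n) (y n); first exact/eqP.
  exists [set z : boxX | A (z n)]; split; last by apply/mem_set; exact: set_mem yA.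
    rewrite openE => z Az; apply/box_nbhsP.
    exists (fun m => if m == n then A else setT); split.
    - by move=> m; case: ifP => _ //; exact: openT.
    - by move=> m; case: eqP => [->|].
    - by move=> z' /(_ n); rewrite eqxx.
  by apply/mem_set; exact: set_mem xA.
rewrite -[a]reprK nabla_fiber; apply: sigma_compact_kernel => //.
  by move=> n; exact: compact_splice.
rewrite -nabla_fiber; apply: (closed_comp (f := \pi_nabla)) => [x _|].
  exact: pi_cont.
exact: accessible_closed_set1.
Qed.

End compact_box.

Theorem theorem27 (X : topologicalType) :
  dominating_number_eq_omega1 ->
  tychonoff_space X ->
  weight_le_omega1 X ->
  hereditarily_D (nabla_product X) /\
  (compact [set: X] -> D_space (box_product X)).
Proof.
move=> d1 [crX hX] wX; have T1 := hausdorff_accessible hX.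
have mN := nabla_omega1_metrizable d1 crX wX.
have nT1 := nabla_accessible T1.
split=> [A|cX].
  apply: omega1_metrizable_D; first exact: omega1_metrizable_sub.
  exact: accessible_sub.
by apply: box_compact_D => //; exact: omega1_metrizable_D.
Qed.
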